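(* Let $\Gamma$ be a nontrivial finite abelian group, and let $n\ge 3$ be an integer. Let $M$ be a lift of the graphic matroid $M(K_n^{\Gamma})$ so that a cycle of $K_n^{\Gamma}$ is a circuit of $M$ if and only if it is balanced. Then either $\Gamma\cong\mathbb{Z}_p^j$ for some prime $p$ and integer $j\ge 2$, or $M$ is an elementary lift of $M(K_n^{\Gamma})$.
   Context: $\mathbb{Z}_p^j$ is the direct sum of $j$ copies of the cyclic group of order $p$. For a finite group $\Gamma$ and integer $n\ge 3$, $K_n^{\Gamma}$ is the (multi)graph with vertex set $[n]=\{1,\dots,n\}$ and edge set $\binom{[n]}{2}\times\Gamma$, where the edge $(\{i,j\},\alpha)$ joins vertices $i$ and $j$. For $i<j$ the edge $e=(\{i,j\},\alpha)$ is oriented from $i$ to $j$ and has label $\phi(e)=\alpha$. For a walk $W$ with edge sequence $e_1,\dots,e_k$, put $\phi(W)=\prod_{t=1}^k\phi(e_t)^{c_t}$ (group written multiplicatively), where $c_t=1$ if $e_t$ is traversed forward in $W$ and $c_t=-1$ if it is traversed backward. A cycle $C$ of $K_n^{\Gamma}$ (including cycles consisting of two parallel edges) is balanced if some (equivalently, every) simple closed walk $W$ around $C$ has $\phi(W)$ equal to the identity of $\Gamma$. Cycles are identified with their edge sets. $M(G)$ is the graphic (cycle) matroid of a graph $G$. A matroid $K$ is a lift of a matroid $M$ if there is a matroid $P$ and a subset $X$ of $E(P)$ so that $P\setminus X=K$ and $P/X=M$. A matroid $M'$ is an elementary lift of $M$ if there is a matroid $P$ with ground set $E(M)\cup\{e\}$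 (with $e\notin E(M)$) so that $P\setminus e=M'$ and $P/e=M$. *)

(* Defs.v *)
From HB Require Import structures.
From mathcomp Require Import all_boot all_order all_algebra all_fingroup all_solvable.

Set Implicit Arguments.
Unset Strict Implicit.
Unset Printing Implicit Defensive.

Definition indep_axioms (T : finType) (I : {set {set T}}) : bool :=
  [&& set0 \in I,
      [forall A in I, forall B : {set T}, (B \subset A) ==> (B \in I)] &
      [forall A in I, forall B in I, (#|A| < #|B|) ==>
         [exists x in B :\: A, (x |: A) \in I]]].

(* The ground set is the whole type [T].  The axioms are boolean, so two
   matroids are equal as soon as they have the same independent sets. *)
Record matroid (T : finType) := Matroid {
  indep : {set {set T}};
  _ : indep_axioms indep
}.
HB.instance Definition _ (T : finType) := [isSub for @indep T].

Section MatroidTheory.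
Variable T : finType.
Implicit Types (P : matroid T) (A B C X : {set T}).

Definition circuit P C : bool := minset (fun A => A \notin indep P) C.

Definition basis_of P X B : bool :=
  maxset (fun A => (A \subset X) && (A \in indep P)) B.

Lemma indep_axiomsP (I : {set {set T}}) :
  reflect [/\ set0 \in I,
              forall A B, A \in I -> B \subset A -> B \in I &
              forall A B, A \in I -> B \in I -> #|A| < #|B| ->
                exists2 x, x \in B :\: A & x |: A \in I]
          (indep_axioms I).
Proof.
apply: (iffP and3P) => [] [I0 Isub Iaug]; split=> //.
- move=> A B AI sBA; move/forall_inP: Isub => /(_ A AI) /forallP /(_ B).
  by rewrite sBA.
- move=> A B AI BI ltAB; move/forall_inP: Iaug => /(_ A AI) /forall_inP.
  by move=> /(_ B BI); rewrite ltAB => /exists_inP.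
- by apply/forall_inP => A AI; apply/forallP => B; apply/implyP; apply: Isub.
apply/forall_inP => A AI; apply/forall_inP => B BI; apply/implyP => ltAB.
by apply/exists_inP; apply: Iaug.
Qed.

Lemma indep0 P : set0 \in indep P.
Proof. by case: P => I /= /indep_axiomsP[]. Qed.

Lemma indepS P A B : A \in indep P -> B \subset A -> B \in indep P.
Proof. by case: P => I /= /indep_axiomsP[_ + _]; apply. Qed.

Lemma indep_aug P A B : A \in indep P -> B \in indep P -> #|A| < #|B| ->
  exists2 x, x \in B :\: A & x |: A \in indep P.
Proof. by case: P => I /= /indep_axiomsP[_ _]; apply. Qed.

Lemma matroid_eqP P Q : (forall A, (A \in indep P) = (A \in indep Q)) -> P = Q.
Proof. by move=> PQ; apply: val_inj; apply/setP. Qed.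

Lemma basis_of_exists P X : exists B, basis_of P X B.
Proof.
have P0 : (set0 \subset X) && (set0 \in indep P) by rewrite sub0set indep0.
have [B maxB _] := @maxset_exists T
  (fun A => (A \subset X) && (A \in indep P)) set0 P0.
by exists B.
Qed.

Lemma basis_of_leq P X B A :
  basis_of P X B -> A \subset X -> A \in indep P -> #|A| <= #|B|.
Proof.
move=> maxB sAX AI; rewrite leqNgt; apply/negP => ltBA.
have /andP[sBX BI] := maxsetp maxB.
have [x /setDP[xA xB] xBI] := indep_aug BI AI ltBA.
have xBX : (x |: B \subset X) && (x |: B \in indep P).
  by rewrite subUset sub1set (subsetP sAX) // sBX xBI.
by case/negP: xB; rewrite -(maxsetsup maxB xBX (subsetUr _ _)) setU11.
Qed.

End MatroidTheory.

(* A matroid [P] whose ground set contains a distinguished subset is taken on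
   a sum type [T + X]: the subset is the copy [inr @: setT] of [X], and both
   minors obtained by removing it live on [T]. *)
Section Minors.
Variables (T X : finType) (P : matroid (T + X)%type).
Implicit Types A B : {set T}.

Let inlS A : {set T + X} := inl @: A.
Let inrX : {set T + X} := inr @: [set: X].

Definition deletion_indep : {set {set T}} :=
  [set A : {set T} | (inl @: A : {set T + X}) \in indep P].

(* [A] is independent in the contraction when it extends some (equivalently,
   every) maximal independent subset of the contracted set. *)
Definition contraction_indep : {set {set T}} :=
  [set A : {set T} | [exists B : {set T + X},
     basis_of P (inr @: [set: X]) B && ((inl @: A :|: B) \in indep P)]].

Let mem_inl (A : {set T}) x : (inl x \in inlS A) = (x \in A).
Proof. by apply: mem_imset => ? ? []. Qed.

Let card_inl A : #|inlS A| = #|A|.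
Proof. by apply: card_imset => ? ? []. Qed.

Let inlU1 x A : inlS (x |: A) = inl x |: inlS A.
Proof. by rewrite /inlS imsetU imset_set1. Qed.

Lemma deletion_axioms : indep_axioms deletion_indep.
Proof.
apply/indep_axiomsP; split=> [|A B|A B]; rewrite !inE.
- by rewrite imset0 indep0.
- by move=> AI sBA; apply: indepS AI _; apply: imsetS.
move=> AI BI ltAB; have [|z] := indep_aug AI BI; first by rewrite !card_inl.
rewrite inE => /andP[zA /imsetP[x xB ez]]; rewrite {z}ez in zA * => xAI.
exists x; first by rewrite inE xB andbT -mem_inl.
by rewrite inE -/(inlS _) inlU1.
Qed.

Lemma contraction_axioms : indep_axioms contraction_indep.
Proof.
have cardU A (C : {set T + X}) :
    basis_of P inrX C -> #|inlS A :|: C| = #|A| + #|C|.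
  move=> /maxsetp/andP[/subsetP sB _]; rewrite cardsU card_inl.
  rewrite (_ : _ :&: _ = set0) ?cards0 ?subn0 //; apply/setP=> z.
  rewrite !inE; apply/negP => /andP[/imsetP[x _ ->] /sB /imsetP[y _]].
  by [].
apply/indep_axiomsP; split=> [|A B|A B]; rewrite !inE.
- have [B bB] := basis_of_exists P inrX; apply/existsP; exists B.
  by rewrite bB imset0 set0U; case/andP: (maxsetp bB).
- move=> /existsP[C /andP[bC CI]] sBA; apply/existsP; exists C.
  by rewrite bC; apply: indepS CI _; apply: setSU; apply: imsetS.
move=> /existsP[C /andP[bC CI]] /existsP[D /andP[bD DI]] ltAB.
have /andP[sC Ci] := maxsetp bC; have /andP[sD Di] := maxsetp bD.
have leDC := basis_of_leq bC sD Di; have leCD := basis_of_leq bD sC Ci.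
have eqCD : #|C| = #|D| by apply/eqP; rewrite eqn_leq leCD.
have [|z] := indep_aug CI DI; first by rewrite !cardU // eqCD ltn_add2r.
rewrite in_setD !in_setU negb_or -andbA => /and3P[zA zC /orP[zB | zD]] zI.
  case/imsetP: zB zA zI zC => x xB -> {z}; rewrite mem_inl => xA zI _.
  exists x; first by rewrite inE xA.
  by rewrite inE; apply/existsP; exists C; rewrite bC /= -/(inlS _) inlU1 -setUA.
suff : #|z |: C| <= #|C| by rewrite cardsU1 zC add1n ltnn.
apply: (basis_of_leq bC); first by rewrite subUset sub1set (subsetP sD).
by apply: indepS zI _; apply: setUS; apply: subsetUr.
Qed.

Definition deletion : matroid T := Matroid deletion_axioms.
Definition contraction : matroid T := Matroid contraction_axioms.

End Minors.

Definition is_lift (T : finType) (K M : matroid T) : Prop :=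
  exists (X : finType) (P : matroid (T + X)%type),
    deletion P = K /\ contraction P = M.

Definition is_elementary_lift (T : finType) (K M : matroid T) : Prop :=
  exists P : matroid (T + unit)%type, deletion P = K /\ contraction P = M.

(* The orientation given by [tail] and [head] is only a reference orientation:
   walks may traverse an edge in either direction. *)
Record multigraph := Multigraph {
  vertex : finType;
  edge : finType;
  tail : edge -> vertex;
  head : edge -> vertex
}.

Section Graphs.
Variable G : multigraph.

(* [(e, true)] is the edge [e] traversed forward, [(e, false)] backward. *)
Definition dart := (edge G * bool)%type.

Definition dart_source (d : dart) : vertex G :=
  if d.2 then tail d.1 else head d.1.
Definition dart_target (d : dart) : vertex G :=
  if d.2 then head d.1 else tail d.1.
Definition consecutive : rel dart :=
  fun d1 d2 => dart_target d1 == dart_source d2.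

(* The edges must be distinct so as to exclude going back and forth along a
   single edge; two parallel edges do form a cycle. *)
Definition simple_closed_walk (w : seq dart) : bool :=
  [&& w != [::], path.cycle consecutive w, uniq (map dart_source w)
    & uniq (map fst w)].

Definition walk_edges (w : seq dart) : {set edge G} :=
  [set e in map fst w].

(* A simple closed walk has as many darts as edges, whence the bounded
   quantification over [#|C|]-tuples; see [is_cycleP]. *)
Definition is_cycle (C : {set edge G}) : bool :=
  [exists w : #|C|.-tuple dart,
     simple_closed_walk w && (walk_edges w == C)].

Lemma size_simple_closed_walk w :
  simple_closed_walk w -> size w = #|walk_edges w|.
Proof.
case/and4P=> _ _ _ /card_uniqP; rewrite size_map => <-.
by apply: eq_card => e; rewrite inE.
Qed.

Lemma is_cycleP C :
  reflect (exists2 w, simple_closed_walk w & walk_edges w = C) (is_cycle C).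
Proof.
apply: (iffP existsP) => [[w /andP[sw /eqP <-]]|[w sw ewC]]; first by exists w.
have sz : size w == #|C| by rewrite -ewC -size_simple_closed_walk.
by exists (Tuple sz); rewrite sw ewC eqxx.
Qed.

Definition forests : {set {set edge G}} :=
  [set A : {set edge G} |
     [forall C : {set edge G}, is_cycle C ==> ~~ (C \subset A)]].

Lemma forestsP (A : {set edge G}) :
  reflect (forall w, simple_closed_walk w -> ~~ (walk_edges w \subset A))
          (A \in forests).
Proof.
rewrite inE; apply: (iffP forallP) => [fA w sw | fA C].
  by apply: (implyP (fA _)); apply/is_cycleP; exists w.
by apply/implyP => /is_cycleP[w sw <-]; apply: fA.
Qed.

Let adj (A : {set edge G}) : rel (vertex G) := fun x y =>
  [exists d : dart,
     [&& d.1 \in A, dart_source d == x & dart_target d == y]].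

Let adj_sym A : symmetric (adj A).
Proof.
suff imp x y : adj A x y -> adj A y x by move=> x y; apply/idP/idP; apply: imp.
case/existsP=> -[e b] /and3P[/= eA /eqP <- /eqP <-].
apply/existsP; exists (e, ~~ b); rewrite /= eA /dart_source /dart_target /=.
by case: b; rewrite !eqxx.
Qed.

Let adj_csym A : connect_sym (adj A).
Proof. exact: sym_connect_sym (@adj_sym A). Qed.

Let path_darts (A : {set edge G}) x p : path (adj A) x p -> uniq (x :: p) ->
  exists ds : seq dart,
  [/\ all (fun d : dart => d.1 \in A) ds, map dart_source ds = belast x p,
      map dart_target ds = p, uniq (map fst ds) &
      forall d, d \in ds -> (tail d.1 \in x :: p) && (head d.1 \in x :: p)].
Proof.
elim: p x => [|y p IHp] x /=; first by exists [::].
case/andP=> /existsP[d /and3P[dA /eqP dx /eqP dy]] yp /andP[xyp uyp].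
have [ds [dsA dss dst uds dsV]] := IHp y yp uyp.
exists (d :: ds); split=> /=; rewrite ?dA ?dx ?dss ?dy ?dst ?uds ?andbT //.
  apply/mapP=> -[d' d'ds ed]; case/negP: xyp; rewrite -dx /dart_source ed.
  by case/andP: (dsV d' d'ds) => ? ?; case: (d.2).
move=> d'; rewrite inE => /orP[/eqP -> | d'ds].
  move: dx dy; rewrite /dart_source /dart_target.
  by case: (d.2) => -> ->; rewrite !inE !eqxx ?orbT.
by case/andP: (dsV d' d'ds); rewrite ![_ \in x :: _]inE => -> ->; rewrite !orbT.
Qed.

Let path_consecutive (d : dart) (ds : seq dart) :
  map dart_source ds = belast (dart_target d) (map dart_target ds) ->
  path consecutive d ds.
Proof.
elim: ds d => //= d' ds IHds d [ed' eds].
by rewrite /consecutive ed' eqxx IHds.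
Qed.

Let connect_cycle (A : {set edge G}) e : e \notin A ->
  connect (adj A) (head e) (tail e) -> e |: A \notin forests.
Proof.
move=> eA /connectP[p0 p0P p0l]; case/shortenP: p0P p0l => p pP up _ pl.
have [ds [dsA dss dst uds _]] := path_darts pP up.
have sw : simple_closed_walk ((e, true) :: ds).
  apply/and4P; split=> //=.
  - apply: path_consecutive; rewrite !map_rcons dss dst belast_rcons.

    by rewrite /dart_source /dart_target /= pl -lastI.
  - rewrite dss /dart_source /= pl -rcons_uniq.
    by rewrite -lastI.
  rewrite uds andbT; apply/mapP=> -[d dds /= ed].
  by case/negP: eA; rewrite ed (allP dsA).
apply/negP => /forestsP fA; case/negP: (fA _ sw); apply/subsetP=> f.
rewrite !inE /= => /orP[-> //|/mapP[d dds ->]].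
by rewrite (allP dsA) ?orbT.
Qed.

Let cycle_connect (A : {set edge G}) e : A \in forests ->
  e |: A \notin forests -> connect (adj A) (head e) (tail e).
Proof.
move=> /forestsP fA; rewrite inE negb_forall => /existsP[C].
rewrite negb_imply negbK => /andP[/is_cycleP[w sw <-{C}] swA].
have [d dw de] : exists2 d, d \in w & d.1 = e.
  have /subsetPn[f] := fA w sw; rewrite inE => /mapP[d dw ->] dA; exists d => //.
  have /(subsetP swA) : d.1 \in walk_edges w by rewrite inE map_f.
  by rewrite !inE (negPf dA) orbF => /eqP.
case/and4P: sw => _ cw _ uw.
case: (rot_to dw) => i q eq.
move: cw uw; rewrite -(rot_cycle i) -(rot_uniq i) -map_rot eq /= => pq.
case/andP=> dq uq.
have qA : all (fun d' : dart => d'.1 \in A) q.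
  apply/allP => d' d'q.
  have : d'.1 \in walk_edges w.
    by rewrite inE map_f // -(mem_rot i) eq inE d'q orbT.
  move/(subsetP swA); rewrite !inE => /orP[/eqP e'|//].
  by case/negP: dq; apply/mapP; exists d' => //; rewrite de e'.
have conn : connect (adj A) (dart_target d) (dart_source d).
  move: (d) pq; rewrite /= => d0.
  have : forall d1, path consecutive d1 (rcons q d0) ->
         connect (adj A) (dart_target d1) (dart_source d0).
    elim: q qA {eq uq dq} => [_|d2 q IHq /= /andP[d2A qA]] d1 /=.
      by rewrite andbT => /eqP ->.
    case/andP=> /eqP -> /(IHq qA); apply: connect_trans.
    by apply: connect1; apply/existsP; exists d2; rewrite d2A !eqxx.
  exact.
move: conn; rewrite /dart_source /dart_target de; case: (d.2) => //.
by rewrite adj_csym.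
Qed.

Import GRing.Theory.
Local Open Scope ring_scope.

(* The exchange property of forests is proved by comparing dimensions of spans
   of incidence vectors. *)
Let inc (e : edge G) : {ffun vertex G -> rat^o} :=
  [ffun v => (v == head e)%:R - (v == tail e)%:R].

Let incs (A : {set edge G}) := <<[seq inc e | e in A]>>%VS.

Let phi (g : vertex G -> rat) (u : {ffun vertex G -> rat^o}) : rat :=
  \sum_v g v * u v.

Let phi_inc g e : phi g (inc e) = g (head e) - g (tail e).
Proof.
have sum_delta x : \sum_v g v * (v == x)%:R = g x.
  rewrite (bigD1 x) //= eqxx mulr1 big1 ?addr0 // => v /negPf ->.
  by rewrite mulr0.
rewrite -[g (head e)]sum_delta -[g (tail e)]sum_delta -sumrB.
by apply: eq_bigr => v _; rewrite ffunE mulrBr.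
Qed.

Let span_connect (A : {set edge G}) e :
  inc e \in incs A -> connect (adj A) (head e) (tail e).
Proof.
pose g v : rat := (connect (adj A) (head e) v)%:R.
have gA f : f \in A -> phi g (inc f) = 0.
  move=> fA; rewrite phi_inc /g.
  have hf : connect (adj A) (head f) (tail f).
    apply: connect1; apply/existsP; exists (f, false).
    by rewrite /= fA /dart_source /dart_target !eqxx.
  by rewrite (same_connect_r (@adj_csym A) hf) subrr.
move=> /coord_span; set c := coord _ => ec.
have : phi g (inc e) = 0.
  rewrite ec /phi.
  under eq_bigr => v _ do rewrite sum_ffunE big_distrr /=.
  rewrite exchange_big /= big1 // => i _.
  have /imageP[f fA ->] : (image_tuple inc A)`_i \in image inc A.
    by rewrite mem_nth // size_tuple.
  under eq_bigr => v _ do rewrite ffunE mulrCA.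
  by rewrite -big_distrr /= -/(phi _ _) gA ?mulr0.
rewrite phi_inc /g connect0; case: connect => //.
Qed.

Let connect_span (A : {set edge G}) e :
  connect (adj A) (head e) (tail e) -> inc e \in incs A.
Proof.
pose del x y : {ffun vertex G -> rat^o} :=
  [ffun v => (v == x)%:R - (v == y)%:R].
have delA x y : adj A x y -> del x y \in incs A.
  case/existsP=> -[f b] /and3P[/= fA /eqP <- /eqP <-].
  have fI : inc f \in incs A by apply: memv_span; apply: image_f.
  rewrite /dart_source /dart_target /=; case: b => //=.
  suff -> : del (tail f) (head f) = - inc f by rewrite memvN.
  by apply/ffunP => v; rewrite !ffunE opprB.
rewrite -[inc e]/(del (head e) (tail e)); case/connectP=> p.
move: (head e) (tail e) => x y.
elim: p x => [|z p IHp] x /=.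
  move=> _ ->; suff -> : del x x = 0 by apply: mem0v.
  by apply/ffunP => v; rewrite !ffunE subrr.
case/andP=> /delA xz /IHp {}IHp /IHp zy.
suff -> : del x y = del x z + del z y by apply: memvD.
by apply/ffunP => v; rewrite !ffunE addrA subrK.
Qed.

Let incsU1 (A : {set edge G}) e : incs (e |: A) = (<[inc e]> + incs A)%VS.
Proof.
rewrite -span_cons; apply: eq_span => u; rewrite inE.
apply/imageP/orP => [[f] | [/eqP -> | /imageP[f fA ->]]].
- by rewrite !inE => /orP[/eqP -> -> | fA ->]; [left|right; apply: image_f].
- by exists e; rewrite ?setU11.
by exists f; rewrite ?setU1r.
Qed.

Let forestsS (A B : {set edge G}) : A \in forests -> B \subset A -> B \in forests.
Proof.
move=> /forestsP fA sBA; apply/forestsP => w sw.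
by apply: contra (fA w sw) => /subset_trans; apply.
Qed.

Let dim_incs (A : {set edge G}) : (\dim (incs A) <= #|A|)%N.
Proof. by rewrite (leq_trans (dim_span _)) ?size_map -?cardE. Qed.

Let dim_forest (A : {set edge G}) : A \in forests -> \dim (incs A) = #|A|.
Proof.
move Dn: #|A| => n; elim: n A Dn => [|n IHn] A cA fA.
  by apply/eqP; rewrite -leqn0 -cA dim_incs.
have /card_gt0P[e eA] : (0 < #|A|)%N by rewrite cA.
have fA' : A :\ e \in forests by apply: forestsS fA _; apply: subsetDl.
have cA' : #|A :\ e| = n by move: cA; rewrite (cardsD1 e) eA => -[].
have e_notin : inc e \notin incs (A :\ e).
  apply: contraL fA => /span_connect /connect_cycle.
  by rewrite setD1K // !inE eqxx; apply.
rewrite -(setD1K eA) incsU1 dimv_disjoint_sum; last first.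
  apply/eqP; rewrite -subv0; apply/subvP => u; rewrite memv_cap memv0.
  case/andP=> /vlineP[k ->] kI; case: (eqVneq k 0) => [->|k0].
    by rewrite scale0r.
  by move: kI; rewrite rpredZeq (negPf k0) (negPf e_notin).
rewrite IHn // dim_vline; case: eqP e_notin => [-> | _ _]; last by [].
by rewrite mem0v.
Qed.

Lemma forests_axioms : indep_axioms forests.
Proof.
apply/indep_axiomsP; split; last 1 first.
- move=> A B fA fB ltAB; apply/exists_inP; apply: contraLR ltAB.
  rewrite negb_exists_in -leqNgt -(dim_forest fA) -(dim_forest fB).
  move=> /forall_inP nAB; apply/dimvS/span_subvP => u /imageP[e eB ->].
  have [eA | eA] := boolP (e \in A); first by apply: memv_span; apply: image_f.
  by apply/connect_span/cycle_connect => //; apply: nAB; rewrite inE eA.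
- apply/forestsP => w; case/and4P; case: w => // d w _ _ _ _.
  by apply/subsetPn; exists d.1; rewrite !inE ?eqxx.
exact: forestsS.
Qed.

Definition graphic_matroid : matroid (edge G) := Matroid forests_axioms.

End Graphs.

Section Gains.
Variables (G : multigraph) (gT : finGroupType) (phi : edge G -> gT).
Local Open Scope group_scope.

Definition walk_gain (w : seq (dart G)) : gT :=
  \prod_(d <- w) (if d.2 then phi d.1 else (phi d.1)^-1).

(* Whether the gain is the identity depends neither on the starting point nor
   on the direction of the walk around [C]. *)
Definition balanced (C : {set edge G}) : bool :=
  [exists w : #|C|.-tuple (dart G),
     [&& simple_closed_walk w, walk_edges w == C & walk_gain w == 1]].

Lemma balancedP C :
  reflect (exists w, [/\ simple_closed_walk w, walk_edges w = C &
                         walk_gain w = 1])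
          (balanced C).
Proof.
apply: (iffP existsP) => [[w /and3P[sw /eqP ew /eqP gw]]|[w [sw ew gw]]].
  by exists w.
have sz : size w == #|C| by rewrite -ew -size_simple_closed_walk.
by exists (Tuple sz); rewrite sw ew gw !eqxx.
Qed.

End Gains.

(* The edge [({i, j}, a)] with [i < j] is encoded as [(i, j, a)]. *)
Definition group_edge (n : nat) (gT : finGroupType) : finType :=
  {e : 'I_n * 'I_n * gT | e.1.1 < e.1.2}.

Definition group_graph (n : nat) (gT : finGroupType) : multigraph :=
  @Multigraph 'I_n (group_edge n gT)
    (fun e => (val e).1.1) (fun e => (val e).1.2).

Definition group_label (n : nat) (gT : finGroupType)
  (e : edge (group_graph n gT)) : gT := (val e).2.

(* Main.v *)
Require Import Defs.
From mathcomp Require Import all_boot all_order all_algebra all_fingroup all_solvable.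
From mathcomp Require Import zify.

Set Implicit Arguments.
Unset Strict Implicit.
Unset Printing Implicit Defensive.

(** Why the theorem holds.  Let N be the graphic matroid, G the graph, and call
    the label of an edge, read along the traversal from i to j, its gain from i
    to j.

    The gap rank M A - rank N A grows with A: for A included in B,
    rank N B - rank N A <= rank M B - rank M A ([lift_rank], a consequence of
    submodularity).  Because of this, M is an elementary lift as soon as
    rank M E <= rank N E + 1 ([elementary_lift_of_rank]).

    Let T be the star of identity edges at vertex 0.  It is a forest, so it has
    the same rank in M and N.  A balanced triangle is a circuit of M, so a flat
    of M that contains an edge of gain g from i to j and one of gain h from j to
    k also contains the edge of gain g h from i to k ([closure_triangle]).  In a
    flat containing T this makes the gain of an edge the only thing that
    matters, and the gains that occur form a subgroup of the group
    ([closure_move], [closure_group_set]).  Let H_a be the subgroup obtained from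
    the flat spanned by T and one edge of gain a.  Since an unbalanced 2-cycle is
    independent in M, an edge with gain b <> 1 is outside the flat spanned by T
    ([nonidentity_notin_closure]); the exchange property then shows that H_a = H_b
    whenever b <> 1 lies in H_a ([gain_class_eq]).

    If some H_a is the whole group, then T and one more edge span M
    and the lift is elementary.  Otherwise the H_a with a <> 1 are
    proper subgroups that cover the group and meet pairwise only in 1.  For x, y in different
    parts, (x y)^#[x] = y^#[x], by commutativity, and this element lies both in the part of x y and in that of y, which is impossible
    unless it is 1; so #[y] divides #[x] ([partition_dvd_order]).  All nonidentity
    elements therefore share one order, which is a prime p by Cauchy's theorem,
    and the group is elementary abelian; it is not of order p, since it has a
    proper nontrivial subgroup. *)

(** * Rank and closure in a matroid *)

Section Rank.
Variables (T : finType) (P : matroid T).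
Implicit Types (A B C I : {set T}).

Definition rank A : nat :=
  \max_(I : {set T} | (I \subset A) && (I \in indep P)) #|I|.

Definition closure A : {set T} := [set x | rank (x |: A) <= rank A].

Lemma indep_le_rank I A : I \subset A -> I \in indep P -> #|I| <= rank A.
Proof.
move=> sIA iI.
by apply: (@leq_bigmax_cond _ _ (fun I : {set T} => #|I|)); rewrite sIA.
Qed.

Lemma indep_extend I A : I \subset A -> I \in indep P ->
  exists J : {set T}, [/\ I \subset J, J \subset A, J \in indep P & #|J| = rank A].
Proof.
move=> sIA iI; have pI : (I \subset A) && (I \in indep P) by rewrite sIA.
have [J bJ sIJ] := @maxset_exists T
  (fun J => (J \subset A) && (J \in indep P)) I pI.
have /andP[sJA iJ] := maxsetp bJ.
exists J; split=> //; apply/eqP; rewrite eqn_leq indep_le_rank //=.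
by apply/bigmax_leqP => B /andP[sBA iB]; apply: basis_of_leq bJ sBA iB.
Qed.

Lemma rank_basis A : exists I : {set T}, [/\ I \subset A, I \in indep P & #|I| = rank A].
Proof.
by have [I [_ sIA iI cI]] := indep_extend (sub0set A) (indep0 P); exists I.
Qed.

Lemma rankS A B : A \subset B -> rank A <= rank B.
Proof.
move=> sAB; have [I [sIA iI <-]] := rank_basis A.
exact: indep_le_rank (subset_trans sIA sAB) iI.
Qed.

Lemma rank_le_card A : rank A <= #|A|.
Proof. by have [I [sIA _ <-]] := rank_basis A; apply: subset_leq_card. Qed.

Lemma rank_indep A : A \in indep P -> rank A = #|A|.
Proof. by move=> iA; apply/eqP; rewrite eqn_leq rank_le_card indep_le_rank. Qed.

Lemma indep_rank A : #|A| <= rank A -> A \in indep P.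
Proof.
move=> leA; have [I [sIA iI cI]] := rank_basis A.
by have -> : A = I by apply/eqP; rewrite eq_sym eqEcard sIA cI.
Qed.

(** A basis of the intersection, extended to a basis J of the union, is cut by A
    and B into independent sets whose sizes add up to at least what is needed. *)
Lemma rank_submodular A B :
  rank (A :|: B) + rank (A :&: B) <= rank A + rank B.
Proof.
have [I [sI iI <-]] := rank_basis (A :&: B).
have sIU : I \subset A :|: B.
  by apply: subset_trans sI _; rewrite subIset // subsetUl.
have [J [sIJ sJ iJ <-]] := indep_extend sIU iI.
have cJ : #|J| = #|J :&: A :|: J :&: B|.
  by rewrite -setIUr; congr #|pred_of_set _|; apply/esym/setIidPl.
have cI : #|I| <= #|J :&: A :&: (J :&: B)|.
  by apply: subset_leq_card; rewrite -setIIr subsetI sIJ.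
rewrite cJ (leq_trans (n := #|J :&: A :|: J :&: B| + #|J :&: A :&: (J :&: B)|)) //.
  by rewrite leq_add2l.
rewrite cardsUI leq_add // indep_le_rank ?subsetIr //.
  by apply: indepS iJ (subsetIl _ _).
by apply: indepS iJ (subsetIl _ _).
Qed.

Lemma rankU1 x A : rank (x |: A) <= (rank A).+1.
Proof.
have := rank_submodular [set x] A; have := rank_le_card [set x].
by rewrite cards1; lia.
Qed.

Lemma sub_closure A : A \subset closure A.
Proof. by apply/subsetP => x xA; rewrite inE (setUidPr _) ?sub1set. Qed.

Lemma rank_setU_closure A B : B \subset closure A -> rank (A :|: B) = rank A.
Proof.
move=> sB; apply/eqP; rewrite eqn_leq (rankS (subsetUl _ _)) andbT leqNgt.
have [I [sI iI cI]] := rank_basis A; have [J [sJ iJ cJ]] := rank_basis (A :|: B).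
apply/negP; rewrite -cI -cJ => /(indep_aug iI iJ)[x /setDP[xJ xI] iX].
have cX : #|x |: I| = (rank A).+1 by rewrite cardsU1 xI cI.
have : rank (x |: A) <= rank A.
  have /setUP[xA|xB] := subsetP sJ x xJ.
    by rewrite (setUidPr _) ?sub1set.
  by have := subsetP sB x xB; rewrite inE.
by rewrite leqNgt -cX indep_le_rank // setUS.
Qed.

(** Adding x to the rest of the circuit leaves its rank unchanged, and by
    submodularity it then leaves the rank of any larger set unchanged. *)
Lemma closure_circuit A C x :
  circuit P C -> x \in C -> C :\ x \subset closure A -> x \in closure A.
Proof.
move=> /minsetP[dC minC] xC /rank_setU_closure rA.
have iCx : C :\ x \in indep P.
  apply: contraT => /minC/(_ (subsetDl _ _)) eC.
  by move: xC; rewrite -eC !inE eqxx.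
have rC : rank C <= #|C :\ x|.
  have : rank C < #|C| by rewrite ltnNge; apply: contra dC; apply: indep_rank.
  by rewrite (cardsD1 x C) xC.
have := rank_submodular (A :|: C :\ x) C.
have := @rankS (C :\ x) ((A :|: C :\ x) :&: C).
have := @rankS (x |: A) ((A :|: C :\ x) :|: C).
rewrite (rank_indep iCx) rA inE subsetI subsetUr subsetDl subUset sub1set.
rewrite -setUA subsetUl !inE xC !orbT /=.
by move=> /(_ isT) ? /(_ isT) ?; lia.
Qed.

(** Adding y to A already produces a set of the rank of x |: A, inside the closure
    of the latter; hence it spans all of that closure. *)
Lemma closure_exchange A x y : y \in closure (x |: A) -> y \notin closure A ->
  closure (x |: A) \subset closure (y |: A).
Proof.
move=> yx; rewrite inE -ltnNge => yA; apply/subsetP => z zx; rewrite inE.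
have rA := rankU1 x A.
have : rank (x |: A :|: [set y; z]) = rank (x |: A).
  by apply: rank_setU_closure; rewrite subUset !sub1set yx.
have : rank (z |: (y |: A)) <= rank (x |: A :|: [set y; z]).
  apply: rankS; apply/subsetP => t; rewrite !inE.
  by case/or3P => ->; rewrite ?orbT.
by lia.
Qed.

End Rank.

(** * Ranks in a lift *)

Section LiftRank.
Variables (T X : finType) (P : matroid (T + X)%type).
Implicit Types A B : {set T}.

Let inlS A : {set T + X} := inl @: A.
Let inrX : {set T + X} := inr @: [set: X].

Let card_inl A : #|inlS A| = #|A|.
Proof. by apply: card_imset => ? ? []. Qed.

Let preimK (B : {set T + X}) A : B \subset inlS A -> inlS (inl @^-1: B) = B.
Proof.
move=> sB; apply/setP => z; apply/imsetP/idP => [[x] | zB].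
  by rewrite inE => ? ->.
by have /imsetP[x _ ez] := subsetP sB z zB; exists x; rewrite ?inE -?ez.
Qed.

Let preimS (B : {set T + X}) A : B \subset inlS A :|: inrX -> inl @^-1: B \subset A.
Proof.
move=> sB; apply/subsetP => x; rewrite inE => /(subsetP sB)/setUP[] /imsetP[y ? //].
by case=> ->.
Qed.

Lemma rank_deletion A : rank (deletion P) A = rank P (inl @: A).
Proof.
apply/eqP; rewrite eqn_leq; apply/andP; split.
  have [I [sI iI <-]] := rank_basis (deletion P) A.
  rewrite -card_inl indep_le_rank ?imsetS //.
  by move: iI; rewrite inE.
have [J [sJ iJ <-]] := rank_basis P (inl @: A).
rewrite -(preimK sJ) card_inl indep_le_rank //.
  exact/preimS/(subset_trans sJ)/subsetUl.
by rewrite inE -/(inlS _) (preimK sJ).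
Qed.

Let card_inlU A (D : {set T + X}) : D \subset inrX -> #|inlS A :|: D| = #|A| + #|D|.
Proof.
move=> /subsetP sD; rewrite cardsU card_inl.
rewrite (_ : _ :&: _ = set0) ?cards0 ?subn0 //; apply/setP=> z.
by rewrite !inE; apply/negP => /andP[/imsetP[x _ ->] /sD /imsetP[y _]].
Qed.

Lemma rank_contraction A :
  rank (contraction P) A + rank P inrX = rank P (inlS A :|: inrX).
Proof.
apply/eqP; rewrite eqn_leq; apply/andP; split.
  have [I [sI iI <-]] := rank_basis (contraction P) A.
  move: iI; rewrite inE => /existsP[D /andP[bD iD]].
  have /andP[sD _] := maxsetp bD.
  have [J [sJ iJ <-]] := rank_basis P inrX.
  rewrite (leq_trans (n := #|inlS I :|: D|)) //.
    by rewrite card_inlU // leq_add2l (basis_of_leq bD).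
  by rewrite indep_le_rank // setUSS ?imsetS.
have [D bD] := basis_of_exists P inrX.
have /andP[sD iD] := maxsetp bD.
have sDU : D \subset inlS A :|: inrX by rewrite (subset_trans sD) ?subsetUr.
have [J [sDJ sJ iJ <-]] := indep_extend sDU iD.
have JE : J = inlS (inl @^-1: J) :|: D.
  apply/setP => z; rewrite inE; apply/idP/orP => [zJ|[/imsetP[x]|/(subsetP sDJ)//]].
    have /setUP[/imsetP[x _ ez]|zX] := subsetP sJ z zJ; [left|right].
      by rewrite ez mem_imset ?inE -?ez // => ? ? [].
    (* D is already maximal among independent sets of contracted elements. *)
    have sJX : J :&: inrX \in indep P by apply: indepS iJ (subsetIl _ _).
    have /eqP-> : D == J :&: inrX.
      by rewrite eqEcard subsetI sDJ sD (basis_of_leq bD) ?subsetIr.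
    by rewrite inE zJ.
  by rewrite inE => xJ ->.
rewrite [X in #|pred_of_set X|]JE card_inlU // leq_add ?indep_le_rank ?preimS //.
by rewrite inE; apply/existsP; exists D; rewrite bD -/(inlS _) -JE.
Qed.

(** Submodularity applied to B and to the union of A with the contracted set. *)
Lemma rank_lift A B : A \subset B ->
  rank (contraction P) B + rank (deletion P) A <=
    rank (deletion P) B + rank (contraction P) A.
Proof.
move=> sAB; rewrite !rank_deletion.
have := rank_submodular P (inlS B) (inlS A :|: inrX).
rewrite setUA (setUidPl (imsetS _ sAB)) -!rank_contraction.
have : rank P (inlS A) <= rank P (inlS B :&: (inlS A :|: inrX)).
  by rewrite rankS // subsetI imsetS // subsetUl.
by rewrite /inlS; lia.
Qed.

End LiftRank.

Lemma lift_rank (T : finType) (K M : matroid T) (A B : {set T}) :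
  is_lift K M -> A \subset B -> rank M B + rank K A <= rank K B + rank M A.
Proof. by move=> [X [P [<- <-]]]; apply: rank_lift. Qed.

Lemma lift_rank_le (T : finType) (K M : matroid T) (A : {set T}) :
  is_lift K M -> rank M A <= rank K A.
Proof.
move=> KM; have := lift_rank KM (sub0set A); have := rank_le_card M set0.
by rewrite cards0; lia.
Qed.

Lemma lift_indep (T : finType) (K M : matroid T) (A : {set T}) :
  is_lift K M -> A \in indep M -> A \in indep K.
Proof.
by move=> KM iA; apply: indep_rank; rewrite -(rank_indep iA) lift_rank_le.
Qed.

(** * A lift of rank at most one more is elementary *)

Section Elementary.
Variables (T : finType) (K M : matroid T).
Hypothesis KM : is_lift K M.
Hypothesis rankKM : rank K [set: T] <= (rank M [set: T]).+1.
Implicit Types A B : {set T}.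

(** The new element is placed so that deleting it gives K and contracting it
    gives M. *)
Definition elementary_indep : {set {set T + unit}} :=
  [set A : {set T + unit} |
    inl @^-1: A \in indep (if inr tt \in A then M else K)].

Let cardE (A : {set T + unit}) :
  #|A| = #|(inl @^-1: A : {set T})| + (inr tt \in A).
Proof.
rewrite (cardsD1 (inr tt)) addnC; congr (_ + _).
rewrite -(@card_imset _ _ (inl : T -> T + unit)) => [|? ? [] //].
apply: eq_card => -[x|[]]; rewrite !inE ?eqxx /=.
  by rewrite mem_imset ?inE // => ? ? [].
by apply/esym/negP => /imsetP[].
Qed.

Let pre1 x (A : {set T + unit}) : inl @^-1: (inl x |: A) = x |: inl @^-1: A.
Proof. by apply/setP => y; rewrite !inE. Qed.

(** Only two cases of the exchange axiom mix K and M.  A set containing the new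
    element can be enlarged from one that avoids it because the rank of the
    latter drops by at most one from K to M, which is where the bound on the
    ranks is used.  Conversely, when A avoids the new element but cannot accept
    it, A is dependent in M; an element raising the rank of A in M is then found
    and, by [lift_rank], it raises the rank of A in K as well. *)
Lemma elementary_axioms : indep_axioms elementary_indep.
Proof.
apply/indep_axiomsP; split=> [|A B|A B].
- by rewrite !inE (_ : _ @^-1: _ = set0) ?indep0 //; apply/setP => x; rewrite !inE.
- rewrite !inE => iA sBA.
  have sp : inl @^-1: B \subset (inl @^-1: A : {set T}) by apply: preimsetS.
  have iB : inl @^-1: B \in indep (if inr tt \in A then M else K) by apply: indepS iA sp.
  case: (boolP (inr tt \in B)) => [/(subsetP sBA) tA|_]; first by rewrite tA in iB.
  by move: iB; case: ifP => // _; apply: lift_indep.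
set a : {set T} := inl @^-1: A; set b : {set T} := inl @^-1: B.
rewrite !inE -/a -/b (cardE A) (cardE B) -/a -/b => iA iB ltAB.
(* Either an old element is added within the matroid that governs A, or the
   new element is added. *)
suff: (exists2 x, x \in b :\: a & x |: a \in indep (if inr tt \in A then M else K))
   \/ (exists2 x, x \in B :\: A & x |: A \in elementary_indep).
  case=> [[x]|//]; rewrite inE => /andP[xa xb] ix; exists (inl x).
    by move: xa xb; rewrite !inE => -> ->.
  by rewrite inE pre1 !inE /=.
case: (boolP (inr tt \in A)) (boolP (inr tt \in B)) iA iB ltAB
  => [tA|tA] [tB|tB] /= iA iB ltAB.
- by left; apply: indep_aug iA iB _; lia.
- have rb := lift_rank KM (subsetT b); rewrite (rank_indep iB) in rb.
  have [J [sJ iJ cJ]] := rank_basis M b.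
  have [|x xJ ix] := indep_aug iA iJ; first by lia.
  by left; exists x => //; case/setDP: xJ => xJ xa; rewrite in_setD xa (subsetP sJ).
- case: (boolP (a \in indep M)) => [iaM|dA].
    right; exists (inr tt); first by rewrite !inE tA tB.
    rewrite !inE eqxx /= (_ : _ @^-1: _ = a) //.
    by apply/setP => y; rewrite !inE.
  left; have [J [sJ iJ cJ]] := rank_basis M a.
  have ltJ : #|J| < #|a|.
    by rewrite cJ ltnNge; apply: contra dA; apply: indep_rank.
  have [|x xJ ix] := indep_aug iJ iB; first by lia.
  have xa : x \notin a.
    apply/negP => xa; have : #|x |: J| <= rank M a.
      by rewrite indep_le_rank // subUset sub1set xa.
    by move: xJ; rewrite -cJ cardsU1 inE => /andP[-> _]; rewrite add1n ltnn.
  have /setDP[xb xJ'] := xJ; exists x; first by rewrite in_setD xa.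
  apply: indep_rank; rewrite cardsU1 xa.
  have := lift_rank KM (subsetUr [set x] a); rewrite (rank_indep iA).
  have : #|x |: J| <= rank M (x |: a) by rewrite indep_le_rank // setUS.
  by move: xJ; rewrite cardsU1 inE => /andP[-> _]; lia.
by left; apply: indep_aug iA iB _; lia.
Qed.

Lemma elementary_lift_of_rank : is_elementary_lift K M.
Proof.
exists (Matroid elementary_axioms); split; apply: matroid_eqP => A.
  rewrite !inE (_ : inr tt \in _ = false); last by apply/negP => /imsetP[].
  by rewrite (_ : _ @^-1: _ = A) //; apply/setP => x; rewrite inE mem_imset // => ? ? [].
have inrE : (inr @: [set: unit] : {set T + unit}) = [set inr tt].
  apply/setP => z; rewrite inE; apply/imsetP/eqP => [[[] _ ->] //|->].
  by exists tt.
have iE : inl @^-1: (inl @: A :|: [set inr tt : T + unit]) = A.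
  by apply/setP => x; rewrite !inE orbF mem_imset // => ? ? [].
have bE : Defs.basis_of (Matroid elementary_axioms) [set inr tt] [set inr tt].
  apply/maxsetP; split=> [|B /andP[sB _] sB']; last by apply/eqP; rewrite eqEsubset sB.
  rewrite subxx /= !inE eqxx (_ : _ @^-1: _ = set0) ?indep0 //.
  by apply/setP => x; rewrite !inE.
rewrite inE inrE; apply/existsP/idP => [[B /andP[bB]]|iA].
  have -> : B = [set inr tt].
    have /andP[sB iB] := maxsetp bB.
    apply/eqP; rewrite eqEcard sB (basis_of_leq bB) //.
    by case/andP: (maxsetp bE).
  by rewrite inE iE !inE eqxx orbT.
by exists [set inr tt]; rewrite bE inE iE !inE eqxx orbT.
Qed.

End Elementary.

(** * Abelian groups partitioned by proper subgroups *)

Section GroupPartition.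
Local Open Scope group_scope.
(* H x is the part of the partition that contains x, for x <> 1. *)
Variables (gT : finGroupType) (H : gT -> {group gT}).
Hypothesis gT_abelian : abelian [set: gT].
Hypothesis mem_H : forall x : gT, x != 1 -> x \in H x.
Hypothesis eq_H : forall x y : gT, x != 1 -> y != 1 -> y \in H x -> H x = H y.
Hypothesis proper_H : forall x : gT, x != 1 -> H x != setT :> {set gT}.

Let comm (x y : gT) : commute x y.
Proof. by apply: (centsP gT_abelian); rewrite inE. Qed.

(** Since x and y commute, (x y)^#[x] = y^#[x].  If this element were not 1, then
    it would lie in the parts of x y and of y, so these parts would agree and
    contain x, putting y in the part of x. *)
Lemma partition_dvd_order (x y : gT) :
  x != 1 -> y != 1 -> y \notin H x -> (#[y] %| #[x])%N.
Proof.
move=> x1 y1 yx; rewrite order_dvdn; apply: contraR yx => z1.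
have [xy1|xy1] := eqVneq (x * y) 1.
  by rewrite -(mulKg x y) xy1 mulg1 groupV mem_H.
have zE : (x * y) ^+ #[x] = y ^+ #[x].
  by rewrite (expgMn _ (comm x y)) expg_order mul1g.
have Hxy : H (x * y) = H y.
  rewrite (@eq_H y (y ^+ #[x])) ?groupX ?mem_H //.
  by rewrite (@eq_H (x * y) (y ^+ #[x])) // -zE groupX ?mem_H.
have xHy : x \in H y.
  by have := mem_H xy1; rewrite Hxy groupMr // mem_H.
by rewrite -(@eq_H y x) // mem_H.
Qed.

(** Two elements of the same part are compared through a third one outside
    it. *)
Lemma partition_order (x y : gT) : x != 1 -> y != 1 -> #[x] = #[y].
Proof.
have diff (u v : gT) : u != 1 -> v != 1 -> v \notin H u -> #[u] = #[v].
  move=> u1 v1 vu; apply/eqP; rewrite eqn_dvd !partition_dvd_order //.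
  by apply: contra vu => uv; rewrite -(@eq_H v u) // mem_H.
move=> x1 y1; have [yx|/diff->//] := boolP (y \in H x).
have [z zx] : exists z, z \notin H x.
  apply/existsP; rewrite -negb_forall; apply: contra (proper_H x1) => /forallP xT.
  by apply/eqP/setP => z; rewrite xT inE.
have z1 : z != 1 by apply: contra zx => /eqP->; apply: group1.
by rewrite (diff x z) // (diff y z) // -(@eq_H x y).
Qed.

Lemma partition_abelem : [set: gT] != 1 :> {set gT} ->
  exists p j : nat,
  [/\ prime p, (2 <= j)%N & p.-abelem [set: gT] /\ #|gT| = (p ^ j)%N].
Proof.
move=> ntG; pose p := pdiv #|[set: gT]|.
have cG : (1 < #|[set: gT]|)%N by rewrite cardG_gt1.
have p_pr : prime p by apply: pdiv_prime.
have [x _ ox] := Cauchy p_pr (pdiv_dvd _).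
have x1 : x != 1 by rewrite -order_gt1 ox prime_gt1.
have abG : p.-abelem [set: gT].
  rewrite abelemE // gT_abelian; apply/exponentP => y _.
  have [->|y1] := eqVneq y 1; first by rewrite expg1n.
  by rewrite -ox (partition_order x1 y1) expg_order.
have [j cj] := p_natP (abelem_pgroup abG); rewrite cardsT in cj.
exists p, j; split=> //.
(* Otherwise the subgroup H x, which contains x of order p, would be everything. *)
rewrite ltnNge; apply: contra (proper_H x1) => j1.
rewrite eqEcard subsetT cardsT cj (leq_trans (n := p)) //.
  by rewrite -{2}[p]expn1 leq_pexp2l ?prime_gt0.
by rewrite -ox subset_leq_card // cycle_subG mem_H.
Qed.

End GroupPartition.

Lemma abelem_isog_rV (gT : finGroupType) (p j : nat) :
  prime p -> p.-abelem%g [set: gT] -> #|gT| = (p ^ j)%N ->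
  [set: gT] \isog [set: 'rV['Z_p]_j].
Proof.
move=> p_pr abG cG; have p1 := prime_gt1 p_pr.
rewrite (isog_abelem_card _ abG) !cardsT cG card_mx mul1n card_ord Zp_cast // eqxx andbT.
rewrite abelemE // FinRing.zmod_abelian; apply/exponentP => x _.
apply/matrixP => i k; rewrite FinRing.zmodXgE mulmxnE -GRing.mulr_natr.
by rewrite pchar_Zp // GRing.mulr0 mxE.
Qed.

(** * Balanced and unbalanced cycles of the labelled graph *)

Lemma walk_edges0 (G : multigraph) : walk_edges [::] = set0 :> {set edge G}.
Proof. by apply/setP => e; rewrite !inE. Qed.

Lemma walk_edges_cons (G : multigraph) (d : dart G) w :
  walk_edges (d :: w) = d.1 |: walk_edges w.
Proof. by apply/setP => e; rewrite !inE. Qed.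

Lemma simple_closed_walk2 (G : multigraph) (d1 d2 : dart G) :
  consecutive d1 d2 -> consecutive d2 d1 -> dart_source d1 != dart_source d2 ->
  d1.1 != d2.1 -> simple_closed_walk [:: d1; d2].
Proof.
by rewrite /simple_closed_walk /= !inE => -> -> -> ->.
Qed.

Lemma simple_closed_walk3 (G : multigraph) (d1 d2 d3 : dart G) :
  consecutive d1 d2 -> consecutive d2 d3 -> consecutive d3 d1 ->
  dart_source d1 != dart_source d2 -> dart_source d2 != dart_source d3 ->
  dart_source d3 != dart_source d1 ->
  d1.1 != d2.1 -> d2.1 != d3.1 -> d3.1 != d1.1 ->
  simple_closed_walk [:: d1; d2; d3].
Proof.
rewrite /simple_closed_walk /= !inE !negb_or => -> -> -> -> -> + -> -> +.
by rewrite eq_sym => -> ; rewrite eq_sym => ->.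
Qed.

Section GainEdges.
Local Open Scope group_scope.
Variables (m : nat) (gT : finGroupType).
Local Notation n := m.+3.
Local Notation G := (group_graph n gT).
Implicit Types (i j k : 'I_n) (g h : gT) (e : edge G).

(** A default value for [gain_edge] at equal end vertices, where no edge exists. *)
Definition base_edge : edge G := Sub (ord0, ord_max, 1) isT.

(** Indexing an edge by its gain from i to j, for i and j in either order, removes
    the reference orientation from all later arguments: reversing the direction
    just inverts the gain ([gain_edgeC]). *)
Definition gain_edge i j g : edge G :=
  insubd base_edge (if i < j then (i, j, g) else (j, i, g^-1)).

Definition gain_dart i j g : dart G := (gain_edge i j g, i < j).

Lemma val_gain_edge i j g : i != j ->
  val (gain_edge i j g) = if i < j then (i, j, g) else (j, i, g^-1).
Proof.
move=> ij; rewrite /gain_edge val_insubd; case: (ltngtP i j) => /= [->|->|] //.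
by move/val_inj => eij; rewrite eij eqxx in ij.
Qed.

Lemma gain_edgeC i j g : i != j -> gain_edge j i g^-1 = gain_edge i j g.
Proof.
move=> ij; apply: val_inj; rewrite !val_gain_edge // 1?eq_sym // invgK.
by case: (ltngtP i j) => // /val_inj eij; rewrite eij eqxx in ij.
Qed.

Lemma gain_edgeP e : exists i j g, i != j /\ e = gain_edge i j g.
Proof.
case: e => -[[i j] g] /= ij; have nij : i != j by rewrite neq_ltn ij.
by exists i, j, g; split=> //; apply: val_inj; rewrite val_gain_edge //= ij.
Qed.

Lemma dart_source_gain i j g : i != j -> dart_source (gain_dart i j g) = i.
Proof. by move=> ij; rewrite /dart_source /= val_gain_edge //; case: (i < j). Qed.

Lemma dart_target_gain i j g : i != j -> dart_target (gain_dart i j g) = j.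
Proof. by move=> ij; rewrite /dart_target /= val_gain_edge //; case: (i < j). Qed.

Lemma walk_gain_cons i j g w : i != j ->
  walk_gain (@group_label n gT) (gain_dart i j g :: w) =
  g * walk_gain (@group_label n gT) w.
Proof.
move=> ij; rewrite /walk_gain big_cons /group_label /= val_gain_edge //.
by case: (i < j); rewrite /= ?invgK.
Qed.

Definition ends e : {set 'I_n} := [set Defs.tail e; Defs.head e].

Lemma ends_gain_edge i j g : i != j -> ends (gain_edge i j g) = [set i; j].
Proof.
by move=> ij; rewrite /ends /= val_gain_edge //; case: (i < j); rewrite //= setUC.
Qed.

Lemma gain_edge_inj i j : i != j -> injective (gain_edge i j).
Proof.
move=> ij g h /(congr1 val); rewrite !val_gain_edge //.
by case: (i < j) => -[] // /invg_inj.
Qed.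

Lemma gain_edge_neq i j k l g h :
  i != j -> k != l -> i \notin [set k; l] -> gain_edge i j g != gain_edge k l h.
Proof.
move=> ij kl; apply: contraNneq => /(congr1 ends); rewrite !ends_gain_edge // => <-.
by rewrite !inE eqxx.
Qed.

Lemma triangle_balanced i j k g h : i != j -> j != k -> k != i ->
  let C := [set gain_edge i j g; gain_edge j k h; gain_edge k i (g * h)^-1] in
  is_cycle C /\ balanced (@group_label n gT) C.
Proof.
move=> ij jk ki C; set gh := (g * h)^-1 in C *.
have [w [sw ew gw]] : exists w, [/\ simple_closed_walk w, walk_edges w = C &
    walk_gain (@group_label n gT) w = 1].
  exists [:: gain_dart i j g; gain_dart j k h; gain_dart k i gh]; split.
  - apply: simple_closed_walk3;
      rewrite /consecutive ?dart_target_gain ?dart_source_gain //.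
    + by apply: gain_edge_neq; rewrite // !inE negb_or ij eq_sym.
    + by apply: gain_edge_neq; rewrite // !inE negb_or jk eq_sym.
    by apply: gain_edge_neq; rewrite // !inE negb_or ki eq_sym.
  - by rewrite !walk_edges_cons walk_edges0 setU0 setUA.
  rewrite (walk_gain_cons g _ ij) (walk_gain_cons h _ jk) (walk_gain_cons gh _ ki).
  by rewrite /walk_gain big_nil mulg1 mulgA mulgV.
by split; [apply/is_cycleP; exists w | apply/balancedP; exists w].
Qed.

Lemma parallel_pair_cycle i j g h : i != j -> g != h ->
  is_cycle [set gain_edge i j g; gain_edge i j h].
Proof.
move=> ij gh; have ji : j != i by rewrite eq_sym.
apply/is_cycleP; exists [:: gain_dart i j g; gain_dart j i h^-1].
  apply: simple_closed_walk2; rewrite /consecutive ?dart_target_gain ?dart_source_gain //.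
  by rewrite /= gain_edgeC // (inj_eq (gain_edge_inj ij)).
by rewrite !walk_edges_cons walk_edges0 setU0 /= gain_edgeC.
Qed.

(** A closed walk around two parallel edges traverses them in opposite
    directions, so its gain is a quotient of their distinct gains. *)
Lemma parallel_pair_unbalanced i j g h : i != j -> g != h ->
  ~~ balanced (@group_label n gT) [set gain_edge i j g; gain_edge i j h].
Proof.
move=> ij gh; apply/negP => /balancedP[w [sw ew gw]].
have szw : size w = 2.
  by rewrite (size_simple_closed_walk sw) ew cards2 (inj_eq (gain_edge_inj ij)) gh.
have ends_w d : d \in w -> exists f, d.1 = gain_edge i j f.
  move=> dw; have : d.1 \in walk_edges w by rewrite inE map_f.
  by rewrite ew !inE => /orP[] /eqP->; [exists g | exists h].
case: w szw sw gw ends_w {ew} => [|[e1 b1] [|[e2 b2] []]] // _ sw gw ends_w.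
have [|f1 /= E1] := ends_w (e1, b1); first by rewrite !inE eqxx.
have [|f2 /= E2] := ends_w (e2, b2); first by rewrite !inE eqxx orbT.
case/and4P: sw => _ /= + _; rewrite !inE andbT => /andP[+ _] ne12.
rewrite /consecutive /dart_target /dart_source /=.
move: gw; rewrite /walk_gain !big_cons big_nil mulg1 /group_label /= E1 E2.
rewrite E1 E2 (inj_eq (gain_edge_inj ij)) in ne12.
have ji : (j == i) = false by rewrite eq_sym (negPf ij).
(* Consecutive darts on parallel edges run in opposite directions. *)
rewrite !val_gain_edge //; move: ne12; clear ends_w E1 E2.
case: (i < j); case: b1; case: b2 => /=;
  rewrite ?ji ?(negPf ij) // ?invgK /= => /andP[ne12 _] /eqP + _.
1,4: by rewrite -eq_mulgV1; apply/negP.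
all: by rewrite -(invgK f2) -eq_mulgV1 (inj_eq invg_inj); apply/negP.
Qed.

(** * The star at vertex 0 *)

Definition star (c : 'I_n -> gT) : {set edge G} :=
  [set gain_edge ord0 j (c j) | j : 'I_n & j != ord0].

Lemma mem_star c j : j != ord0 -> gain_edge ord0 j (c j) \in star c.
Proof. by move=> j0; apply/imsetP; exists j; rewrite ?inE. Qed.

Lemma star_leaf c e j : e \in star c -> j \in ends e -> j != ord0 ->
  e = gain_edge ord0 j (c j).
Proof.
case/imsetP=> k; rewrite inE => k0 ->; have ok : ord0 != k by rewrite eq_sym.
rewrite (ends_gain_edge _ ok) !inE.
by case: eqP => //= _ /eqP->.
Qed.

Lemma dart_source_ends (d : dart G) : dart_source d \in ends d.1.
Proof. by rewrite /dart_source !inE; case: d.2; rewrite eqxx ?orbT. Qed.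

Lemma dart_target_ends (d : dart G) : dart_target d \in ends d.1.
Proof. by rewrite /dart_target !inE; case: d.2; rewrite eqxx ?orbT. Qed.

Lemma dart_source_neq_target (d : dart G) : dart_source d != dart_target d.
Proof.
case: d => -[[[i j] g] /= ij] b; rewrite /dart_source /dart_target /=.
by case: b; rewrite neq_ltn ij ?orbT.
Qed.

(** A closed walk that enters a leaf has to leave it along the same edge, the only
    one there; and every walk in the star visits a leaf within two steps.  The
    star is allowed an arbitrary gain c j at each leaf j because single edges are
    also seen to be forests by placing them in such a star. *)
Lemma star_forest c : star c \in forests G.
Proof.
apply/forestsP => w sw; apply/negP => /subsetP w_star.
have leaf d j : d \in w -> j \in ends d.1 -> j != ord0 ->
    d.1 = gain_edge ord0 j (c j).
  by move=> dw; apply: star_leaf; apply: w_star; rewrite inE map_f.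
have turn d d' : d \in w -> d' \in w -> consecutive d d' ->
    dart_target d != ord0 -> d.1 = d'.1.
  move=> dw d'w /eqP dd' d0; rewrite (leaf d (dart_target d)) ?dart_target_ends //.
  by rewrite (leaf d' (dart_target d)) // dd' dart_source_ends.
have center d : d \in w -> dart_source d = ord0 -> dart_target d != ord0.
  by move=> _ <-; rewrite eq_sym dart_source_neq_target.
case/and4P: sw => w0 cw _ uw.
case: w w0 cw uw turn center {w_star leaf} => [|d1 [|d2 q]] // _.
  by rewrite /= /consecutive andbT eq_sym (negPf (dart_source_neq_target d1)).
move=> /= /andP[c12 cq] /andP[+ /andP[+ _]] turn center.
rewrite inE negb_or => /andP[n12 _] nq.
have w1 : d1 \in [:: d1, d2 & q] by rewrite inE eqxx.
have w2 : d2 \in [:: d1, d2 & q] by rewrite !inE eqxx orbT.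
(* The first or the second dart enters a leaf; the next one, possibly d1 again,
   leaves it. *)
have [t1|t1] := eqVneq (dart_target d1) ord0; last first.
  by case/eqP: n12; apply: turn.
have t2 : dart_target d2 != ord0 by apply: center; rewrite // -t1 (eqP c12).
case: q cq nq turn {center} w1 w2 => [|d3 q] /= /andP[c23 _] nq turn w1 w2.
  by case/eqP: n12; rewrite (turn d2 d1).
case/negP: nq; rewrite (turn d2 d3) ?inE ?eqxx ?orbT //.
Qed.

End GainEdges.

(** * Flats of the lift and the subgroups they define *)

Section BalancedLift.
Local Open Scope group_scope.
Variables (m : nat) (gT : finGroupType).
Local Notation n := m.+3.
Local Notation G := (group_graph n gT).
Variable M : matroid (edge G).
Hypothesis M_lift : is_lift M (graphic_matroid G).
Hypothesis M_balanced : forall C : {set edge G}, is_cycle C ->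
  (circuit M C <-> balanced (@group_label n gT) C).
Implicit Types (i j k : 'I_n) (a b g h : gT) (A : {set edge G}).

Let o : 'I_n := ord0.
Let u : 'I_n := Ordinal (isT : 1 < n).
Let v : 'I_n := Ordinal (isT : 2 < n).

Let T : {set edge G} := star (fun=> 1).
Let E a : edge G := gain_edge o u a.

Lemma closure_triangle A i j k g h : i != j -> j != k -> k != i ->
  gain_edge i j g \in closure M A -> gain_edge j k h \in closure M A ->
  gain_edge i k (g * h) \in closure M A.
Proof.
move=> ij jk ki Aij Ajk; rewrite -gain_edgeC 1?eq_sym //.
have [cC bC] := triangle_balanced g h ij jk ki.
apply: (closure_circuit ((M_balanced cC).2 bC)); first by rewrite !inE eqxx orbT.
apply/subsetP => e /setD1P[ne] /setUP[/set2P[]->//|/set1P ee].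
by rewrite ee eqxx in ne.
Qed.

Section Over.
Variable A : {set edge G}.
Hypothesis sTA : T \subset A.

(** When neither end is vertex 0, the path through that vertex consists of two
    edges of T and has gain 1. *)
Lemma closure_identity i j : i != j -> gain_edge i j 1 \in closure M A.
Proof.
have from_o k : k != o -> gain_edge o k 1 \in closure M A.
  by move=> k0; apply/(subsetP (sub_closure M A))/(subsetP sTA)/mem_star.
have to_o k : k != o -> gain_edge k o 1 \in closure M A.
  by move=> k0; rewrite -[1]invg1 gain_edgeC 1?eq_sym // from_o.
have [->|i0] := eqVneq i o; first by move=> oj; rewrite from_o // eq_sym.
have [->|j0] := eqVneq j o; first by rewrite to_o.
move=> ij; rewrite -[1]mulg1; apply: (@closure_triangle _ i o j) => //.
- by rewrite eq_sym.
- by rewrite eq_sym.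
- exact: to_o.
exact: from_o.
Qed.

(** Composing with an identity edge moves one end vertex and keeps the gain. *)
Lemma closure_move_target i j k g : i != j -> i != k ->
  gain_edge i j g \in closure M A -> gain_edge i k g \in closure M A.
Proof.
move=> ij ik Aij; have [<-//|jk] := eqVneq j k.
rewrite -[g]mulg1; apply: (@closure_triangle _ i j k) => //; first by rewrite eq_sym.
exact: closure_identity.
Qed.

Lemma closure_move_source i j k g : i != j -> k != j ->
  gain_edge i j g \in closure M A -> gain_edge k j g \in closure M A.
Proof.
move=> ij kj Aij; have [<-//|ik] := eqVneq i k.
rewrite -[g]mul1g; apply: (@closure_triangle _ k i j) => //.
- by rewrite eq_sym.
- by rewrite eq_sym.
by apply: closure_identity; rewrite eq_sym.
Qed.

(** Moving one end vertex at a time, the third vertex v gives the room needed to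
    exchange the two ends; this is where n >= 3 matters. *)
Lemma closure_move i j g : i != j -> E g \in closure M A ->
  gain_edge i j g \in closure M A.
Proof.
move=> ij Ag; have [j0|j0] := eqVneq j o; last first.
  apply: (@closure_move_source o) => //; first by rewrite eq_sym.
  by apply: (@closure_move_target o u) => //; rewrite eq_sym.
subst j; apply: (@closure_move_source u) => //.
apply: (@closure_move_target u v) => //.
by apply: (@closure_move_source o v) => //; apply: (@closure_move_target o u).
Qed.

(** The product of two gains is the gain of the third side of a triangle, moved
    back to the vertices 0 and 1. *)
Lemma closure_group_set : group_set [set g | E g \in closure M A].
Proof.
pose H := [set g | E g \in closure M A]; have mem_H g : (g \in H) = (E g \in closure M A).
  by rewrite in_set.
apply/group_setP; rewrite -/H; split=> [|g h]; rewrite !mem_H.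
  exact: closure_identity.
move=> Ag Ah; apply: (@closure_move_target o v) => //.
by apply: (@closure_triangle _ o u v) => //; apply: closure_move.
Qed.

End Over.

Lemma rank_star : rank M T = #|T|.
Proof. by apply/rank_indep/(lift_indep M_lift)/star_forest. Qed.

(** The edge of gain b and the identity edge parallel to it form an unbalanced
    cycle, on which the rank of M exceeds that of the graphic matroid.  By
    [lift_rank] this excess persists on T together with the edge, whereas T has
    the same rank in both matroids. *)
Lemma nonidentity_notin_closure b : b != 1 -> E b \notin closure M T.
Proof.
move=> b1; have ou : o != u by [].
pose C := [set E 1; E b].
have iE g : [set E g] \in indep M.
  apply: (lift_indep M_lift).
  apply: (@indepS _ (graphic_matroid G) _ _ (star_forest (fun=> g))).
  by rewrite sub1set; apply: mem_star.
have iC : C \in indep M.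
  apply: contraT => dC; case/negP: (parallel_pair_unbalanced ou b1).
  rewrite setUC; apply/(M_balanced _).
    by apply: parallel_pair_cycle; rewrite // eq_sym.
  apply/minsetP; split=> // D dD sDC; apply/eqP; rewrite eqEsubset sDC.
  have memD g h : D \subset [set E g; E h] -> E g \in D.
    move=> sD; apply: contraR dD => gD; apply: (indepS (iE h)).
    apply/subsetP => e eD; have := subsetP sD e eD; rewrite !inE.
    by case: eqP eD => //= ->; rewrite (negPf gD).
  by rewrite subUset !sub1set (memD 1 b) // (memD b 1) // setUC.
have cC : #|C| = 2 by rewrite cards2 (inj_eq (gain_edge_inj ou)) eq_sym b1.
have dC : rank (graphic_matroid G) C <= 1.
  rewrite -ltnS -cC ltnNge; apply/negP => /indep_rank /forestsP fC.
  have /is_cycleP[w sw ew] : is_cycle C by apply: parallel_pair_cycle; rewrite // eq_sym.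
  by have := fC w sw; rewrite ew subxx.
have sC : C \subset E b |: T.
  by rewrite subUset !sub1set setU11 setU1r //; apply: (mem_star (fun=> 1)).
have := lift_rank M_lift sC; rewrite (rank_indep iC) cC.
have : #|T| <= rank (graphic_matroid G) (E b |: T).
  by apply: (@indep_le_rank _ (graphic_matroid G)) (star_forest _); apply: subsetUr.
rewrite in_set -rank_star; lia.
Qed.

Let over a : {set edge G} := E a |: T.

Definition gain_class a : {group gT} :=
  Group (closure_group_set (subsetUr [set E a] T)).

Lemma mem_gain_class a b : (b \in gain_class a) = (E b \in closure M (over a)).
Proof. by rewrite in_set. Qed.

Lemma gain_class_id a : a \in gain_class a.
Proof. by rewrite mem_gain_class; apply/(subsetP (sub_closure _ _))/setU11. Qed.

Lemma gain_class_eq a b : a != 1 -> b != 1 -> b \in gain_class a ->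
  gain_class a = gain_class b.
Proof.
have sub a' b' : b' != 1 -> b' \in gain_class a' -> gain_class a' \subset gain_class b'.
  move=> b1; rewrite mem_gain_class => ba; apply/subsetP => g; rewrite !mem_gain_class.
  by apply/subsetP/closure_exchange => //; apply: nonidentity_notin_closure.
move=> a1 b1 ba; apply/val_inj/eqP; rewrite eqEsubset /= sub //=.
by rewrite sub // (subsetP (sub _ _ b1 ba)) ?gain_class_id.
Qed.

Lemma elementary_of_gain_class a : gain_class a = setT :> {set gT} ->
  is_elementary_lift M (graphic_matroid G).
Proof.
move=> aT; apply: elementary_lift_of_rank => //.
have span : [set: edge G] \subset closure M (over a).
  apply/subsetP => e _; have [i [j [g [ij ->]]]] := gain_edgeP e.
  apply: closure_move; rewrite ?subsetUr // -mem_gain_class.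
  by rewrite -[_ \in _]/(g \in (gain_class a : {set gT})) aT inE.
have := rank_setU_closure span; rewrite setUT => ->.
have := rankU1 M (E a) T; rewrite rank_star -/(over a).
have : #|T| <= rank (graphic_matroid G) [set: edge G].
  by apply: (@indep_le_rank _ (graphic_matroid G)) (star_forest _); apply: subsetT.
lia.
Qed.

End BalancedLift.

Theorem theorem1p4 (gT : finGroupType) (n : nat)
  (gT_abelian : abelian [set: gT])
  (gT_nontrivial : [set: gT] != 1%g :> {set gT})
  (n_ge3 : (3 <= n)%N)
  (M : matroid (edge (group_graph n gT)))
  (M_lift : is_lift M (graphic_matroid (group_graph n gT)))
  (M_balanced : forall C : {set edge (group_graph n gT)}, is_cycle C ->
     (circuit M C <-> balanced (@group_label n gT) C)) :
  (exists (p j : nat), [/\ prime p, (2 <= j)%N &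
     [set: gT] \isog [set: 'rV['Z_p]_j]])
  \/ is_elementary_lift M (graphic_matroid (group_graph n gT)).
Proof.
case: n n_ge3 M M_lift M_balanced => [|[|[|m]]] // _ M M_lift M_balanced.
pose H := gain_class M_balanced.
case: (boolP [exists a, H a == [set: gT] :> {set gT}]) => [/existsP[a /eqP aT]|noT].
  by right; apply: elementary_of_gain_class aT.
left; have properH a : a != 1%g -> H a != [set: gT] :> {set gT}.
  by move=> _; apply: contra noT => aT; apply/existsP; exists a.
have [|a b|p [j [p_pr j2 [abG cG]]]] :=
  partition_abelem gT_abelian _ _ properH gT_nontrivial.
- by move=> a _; apply: gain_class_id.
- exact: gain_class_eq.
by exists p, j; split=> //; apply: abelem_isog_rV.
Qed.
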